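(* Let $\Gamma$ be a finitely generated abelian group and let $\alpha:\Gamma\to\Gamma$ be an endomorphism. Then $$GR(\alpha)=\max\{|\lambda_1|,|\lambda_2|,\dots,|\lambda_r|\},$$ where $\lambda_1,\dots,\lambda_r$ are the eigenvalues of $\alpha\otimes 1$ on $\Gamma\otimes\mathbb{C}$.
   Context: For a group $\Gamma$ with finite generating set $S$ and $\gamma\in\Gamma$, $|\gamma|_S$ denotes the length of the shortest word in the letters $S\cup S^{-1}$ representing $\gamma$. The growth rate of an endomorphism $\alpha:\Gamma\to\Gamma$ is $GR(\alpha)=\sup_{\gamma\in\Gamma}\ \limsup_{m\to\infty}\sqrt[m]{|\alpha^m(\gamma)|_S}$. The tensor product $\Gamma\otimes\mathbb{C}$ is over $\mathbb{Z}$.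
   Formalization: As stated it fails for 0×id on Z×Z/2 (growth rate 1, only eigenvalue 0); it is proved assuming that α⊗1 has a nonzero eigenvalue or that every torsion element is sent to 0 by some power of α; the max over no eigenvalues is read as 0. *)

(* Defs.v *)
From HB Require Import structures.
From mathcomp Require Import all_boot all_order all_algebra.
From mathcomp Require Import generic_quotient complex.
From mathcomp Require Import boolp classical_sets reals ereal topology.
From mathcomp Require Import sequences exp.

Set Implicit Arguments.
Unset Strict Implicit.
Unset Printing Implicit Defensive.

Import Order.TTheory GRing.Theory Num.Theory.

Local Open Scope ring_scope.
Local Open Scope classical_set_scope.
Local Open Scope quotient_scope.

Section Growth.
Variables (G : zmodType) (S : seq G).

(* Groups are written additively, so the letters in S^-1 are the opposites
   of elements of S. *)
Definition is_word (g : G) (w : seq G) : Prop :=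
  all (fun x => (x \in S) || (- x \in S)) w /\ \sum_(x <- w) x = g.

Definition generates : Prop := forall g, exists w, is_word g w.

Definition is_word_length (g : G) (n : nat) : Prop :=
  (exists2 w, is_word g w & size w = n) /\
  (forall w, is_word g w -> (n <= size w)%N).

(* The default value 0 is only used when no word represents g. *)
Definition word_length (g : G) : nat := xget 0%N (is_word_length g).

Lemma word_lengthP (g : G) : generates -> is_word_length g (word_length g).
Proof.
move=> /(_ g) [w0 hw0]; rewrite /word_length.
suff [n hn] : exists n, is_word_length g n by apply: (xgetPex 0%N); exists n.
have exP : exists n, `[< exists2 w, is_word g w & size w = n >].
  by exists (size w0); apply/asboolP; exists w0.
exists (ex_minn exP); case: ex_minnP => n /asboolP hn min_n; split=> // w hw.
by apply: min_n; apply/asboolP; exists w.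
Qed.

(* Real-exponent power is used for the m-th root; the term m = 0 is irrelevant
   to the limit superior. *)
Definition growth_rate (R : realType) (alpha : G -> G) : \bar R :=
  ereal_sup [set limn_esup (fun m : nat =>
    (powR ((word_length (iter m alpha g))%:R : R) (m%:R^-1))%:E) | g in setT].

End Growth.

(* The tensor product of an abelian group G with a ring K, over the integers:
   the list [:: (g1, z1); ..; (gn, zn)] stands for the sum of the gi (x) zi,
   and lists are identified under the congruence generated by biadditivity and
   commutativity. Z-balancedness (g *~ n, z) ~ (g, z *~ n) follows from
   biadditivity. *)
Section Tensor.
Variables (G : zmodType) (K : nzRingType).

Inductive tensor_eq : seq (G * K) -> seq (G * K) -> Prop :=
| tensor_refl s : tensor_eq s s
| tensor_sym s t : tensor_eq s t -> tensor_eq t s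
| tensor_trans s t u : tensor_eq s t -> tensor_eq t u -> tensor_eq s u
| tensor_cat s s' t t' :
    tensor_eq s s' -> tensor_eq t t' -> tensor_eq (s ++ t) (s' ++ t')
| tensor_catC s t : tensor_eq (s ++ t) (t ++ s)
| tensor_0l z : tensor_eq [:: (0, z)] [::]
| tensor_Dl g h z : tensor_eq [:: (g + h, z)] [:: (g, z); (h, z)]
| tensor_Dr g y z : tensor_eq [:: (g, y + z)] [:: (g, y); (g, z)].

Lemma tensor_middle s t u : tensor_eq (t ++ s ++ u) (s ++ t ++ u).
Proof.
rewrite !catA; exact: tensor_cat (tensor_catC _ _) (tensor_refl _).
Qed.

Definition tensor_eqb (s t : seq (G * K)) : bool := `[< tensor_eq s t >].

Lemma tensor_eqb_refl : reflexive tensor_eqb.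
Proof. by move=> s; apply/asboolP/tensor_refl. Qed.
Lemma tensor_eqb_sym : symmetric tensor_eqb.
Proof. by move=> s t; apply/asboolP/asboolP; apply: tensor_sym. Qed.
Lemma tensor_eqb_trans : transitive tensor_eqb.
Proof.
by move=> t s u /asboolP st /asboolP tu; apply/asboolP/(tensor_trans st tu).
Qed.

Canonical tensor_equiv :=
  EquivRel tensor_eqb tensor_eqb_refl tensor_eqb_sym tensor_eqb_trans.

Definition tensor := {eq_quot tensor_equiv}.
HB.instance Definition _ := Choice.on tensor.
HB.instance Definition _ := Quotient.on tensor.
HB.instance Definition _ := EqQuotient.on tensor.

Definition pure (g : G) (z : K) : tensor := \pi_tensor [:: (g, z)].

Lemma tensor_piE s t : tensor_eq s t <-> \pi_tensor s = \pi_tensor t.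
Proof.
split=> [st|/eqP]; first by apply/eqmodP/asboolP.
by rewrite eqmodE => /asboolP.
Qed.

Lemma tensor_reprK s : tensor_eq (repr (\pi_tensor s)) s.
Proof. by apply/tensor_piE; rewrite reprK. Qed.

Lemma tensorP (u : tensor) : exists s, u = \pi_tensor s.
Proof. by exists (repr u); rewrite reprK. Qed.

Definition opp_list (s : seq (G * K)) := [seq (- p.1, p.2) | p <- s].
Definition scale_list (c : K) (s : seq (G * K)) :=
  [seq (p.1, c * p.2) | p <- s].

Lemma scale_list_eq c s t :
  tensor_eq s t -> tensor_eq (scale_list c s) (scale_list c t).
Proof.
elim=> {s t} [s|s t _|s t u _ st _|s s' t t' _ ss' _ tt'|s t|z|g h z|g y z].
- exact: tensor_refl.
- exact: tensor_sym.
- exact: tensor_trans.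
- by rewrite /scale_list !map_cat; apply: tensor_cat.
- by rewrite /scale_list !map_cat; apply: tensor_catC.
- exact: tensor_0l.
- exact: tensor_Dl.
- by rewrite /= mulrDr; apply: tensor_Dr.
Qed.

Lemma opp_list_eq s t :
  tensor_eq s t -> tensor_eq (opp_list s) (opp_list t).
Proof.
elim=> {s t} [s|s t _|s t u _ st _|s s' t t' _ ss' _ tt'|s t|z|g h z|g y z].
- exact: tensor_refl.
- exact: tensor_sym.
- exact: tensor_trans.
- by rewrite /opp_list !map_cat; apply: tensor_cat.
- by rewrite /opp_list !map_cat; apply: tensor_catC.
- by rewrite /= oppr0; apply: tensor_0l.
- by rewrite /= opprD; apply: tensor_Dl.
- exact: tensor_Dr.
Qed.

Definition tensor_zero : tensor := \pi_tensor [::].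
Definition tensor_add (u v : tensor) : tensor := \pi_tensor (repr u ++ repr v).
Definition tensor_opp (u : tensor) : tensor := \pi_tensor (opp_list (repr u)).
Definition tensor_scale (c : K) (u : tensor) : tensor :=
  \pi_tensor (scale_list c (repr u)).

Lemma tensor_add_pi s t :
  tensor_add (\pi_tensor s) (\pi_tensor t) = \pi_tensor (s ++ t).
Proof. by apply/tensor_piE/tensor_cat; apply: tensor_reprK. Qed.

Lemma tensor_opp_pi s : tensor_opp (\pi_tensor s) = \pi_tensor (opp_list s).
Proof. by apply/tensor_piE/opp_list_eq/tensor_reprK. Qed.

Lemma tensor_scale_pi c s :
  tensor_scale c (\pi_tensor s) = \pi_tensor (scale_list c s).
Proof. by apply/tensor_piE/scale_list_eq/tensor_reprK. Qed.

Lemma tensor_addA : associative tensor_add.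
Proof.
move=> u v w; case: (tensorP u) (tensorP v) (tensorP w) => s -> [t ->] [r ->].
by rewrite !tensor_add_pi catA.
Qed.

Lemma tensor_addC : commutative tensor_add.
Proof.
move=> u v; case: (tensorP u) (tensorP v) => s -> [t ->]; rewrite !tensor_add_pi.
exact/tensor_piE/tensor_catC.
Qed.

Lemma tensor_add0 : left_id tensor_zero tensor_add.
Proof. by move=> u; case: (tensorP u) => s ->; rewrite tensor_add_pi. Qed.

Lemma tensor_addN : left_inverse tensor_zero tensor_opp tensor_add.
Proof.
move=> u; case: (tensorP u) => s ->; rewrite tensor_opp_pi tensor_add_pi; apply/tensor_piE.
elim: s => [|[g z] s IHs] /=; first exact: tensor_refl.
apply: (@tensor_trans _ ([:: (- g, z); (g, z)] ++ (opp_list s ++ s))).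
  apply: (tensor_cat (tensor_refl [:: (- g, z)])).
  exact: (tensor_middle [:: (g, z)] (opp_list s) s).
apply: (tensor_cat (s' := [::]) (t' := [::])) => //.
apply: tensor_trans (tensor_0l z); apply: tensor_sym.
by rewrite -[X in (X, _)](addNr g); apply: tensor_Dl.
Qed.

HB.instance Definition _ := GRing.isZmodule.Build tensor
  tensor_addA tensor_addC tensor_add0 tensor_addN.

Lemma tensor_scaleA a b v :
  tensor_scale a (tensor_scale b v) = tensor_scale (a * b) v.
Proof.
case: (tensorP v) => s ->; rewrite !tensor_scale_pi /scale_list -map_comp.
by congr (\pi_tensor _); apply: eq_map => p /=; rewrite mulrA.
Qed.

Lemma tensor_scale1 : left_id 1 tensor_scale.
Proof.
move=> u; case: (tensorP u) => s ->; rewrite tensor_scale_pi /scale_list.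
by congr (\pi_tensor _); rewrite -[RHS]map_id; apply: eq_map => -[g z] /=;
  rewrite mul1r.
Qed.

Lemma tensor_scaleDr : right_distributive tensor_scale +%R.
Proof.
move=> c; move=> u v; case: (tensorP u) (tensorP v) => s -> [t ->].
by rewrite /GRing.add /= tensor_add_pi !tensor_scale_pi tensor_add_pi
  /scale_list map_cat.
Qed.

Lemma tensor_scaleDl v :
  {morph tensor_scale^~ v : a b / a + b}.
Proof.
move=> a b; case: (tensorP v) => s -> /=.
rewrite [RHS]/GRing.add /= !tensor_scale_pi tensor_add_pi; apply/tensor_piE.
elim: s => [|[g z] s IHs]; first exact: tensor_refl.
rewrite /= mulrDl -/(scale_list _ _).
apply: (@tensor_trans _ ([:: (g, a * z); (g, b * z)] ++
                         (scale_list a s ++ scale_list b s))).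
  rewrite -cat1s; apply: tensor_cat IHs; exact: tensor_Dr.
apply: (tensor_cat (tensor_refl [:: (g, a * z)])).
exact: (tensor_middle (scale_list a s) [:: (g, b * z)] (scale_list b s)).
Qed.

HB.instance Definition _ := GRing.Zmodule_isLmodule.Build K tensor
  tensor_scaleA tensor_scale1 tensor_scaleDr tensor_scaleDl.

Lemma pureDl g h z : pure (g + h) z = pure g z + pure h z.
Proof.
by rewrite [RHS]/GRing.add /= tensor_add_pi; apply/tensor_piE/tensor_Dl.
Qed.

Lemma pureDr g y z : pure g (y + z) = pure g y + pure g z.
Proof.
by rewrite [RHS]/GRing.add /= tensor_add_pi; apply/tensor_piE/tensor_Dr.
Qed.

Lemma scale_pure c g z : c *: pure g z = pure g (c * z).
Proof. by rewrite /GRing.scale /= tensor_scale_pi. Qed.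

Lemma pi_sum_pure s : \pi_tensor s = \sum_(p <- s) pure p.1 p.2.
Proof.
elim: s => [|[g z] s IHs]; first by rewrite big_nil.
by rewrite big_cons -IHs [RHS]/GRing.add /= tensor_add_pi.
Qed.

Section Universal.
Variables (A : zmodType) (b : G -> K -> A).
Hypotheses (bDl : forall g h z, b (g + h) z = b g z + b h z)
           (bDr : forall g y z, b g (y + z) = b g y + b g z).

Definition tensor_lift (u : tensor) : A := \sum_(p <- repr u) b p.1 p.2.

Lemma tensor_lift_pi s : tensor_lift (\pi_tensor s) = \sum_(p <- s) b p.1 p.2.
Proof.
have b0 z : b 0 z = 0 by apply: (addrI (b 0 z)); rewrite -bDl !addr0.
suff sumE t r : tensor_eq t r ->
    \sum_(p <- t) b p.1 p.2 = \sum_(p <- r) b p.1 p.2.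
  exact/sumE/tensor_reprK.
elim=> {t r} //.
- by move=> ? ? ? _ -> _ ->.
- by move=> ? ? ? ? _ e1 _ e2; rewrite !big_cat /= e1 e2.
- by move=> ? ?; rewrite !big_cat /= addrC.
- by move=> z; rewrite big_seq1 big_nil.
- by move=> g h z; rewrite !big_cons big_nil !addr0 bDl.
- by move=> g y z; rewrite !big_cons big_nil !addr0 bDr.
Qed.

Lemma tensor_universal :
  exists! f : tensor -> A,
    {morph f : u v / u + v} /\ forall g z, f (pure g z) = b g z.
Proof.
exists tensor_lift; split; first split.
- move=> u v; case: (tensorP u) (tensorP v) => s -> [t ->].
  by rewrite [X in tensor_lift X]/GRing.add /= tensor_add_pi !tensor_lift_pi
    big_cat.
- by move=> g z; rewrite tensor_lift_pi big_seq1.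
move=> f [fD fp]; apply/funext; move=> u; case: (tensorP u) => s ->; rewrite tensor_lift_pi.
have f0 : f 0 = 0 by apply: (addrI (f 0)); rewrite -fD !addr0.
rewrite pi_sum_pure; elim: s => [|p s IHs]; first by rewrite !big_nil.
by rewrite !big_cons fD fp IHs.
Qed.

End Universal.

End Tensor.

Section TensorMap.
Variables (G : zmodType) (K : nzRingType) (alpha : {additive G -> G}).

Definition tensor_map : tensor G K -> tensor G K :=
  tensor_lift (fun g z => pure (alpha g) z).

Lemma tensor_map_pi s :
  tensor_map (\pi_(tensor G K) s) = \sum_(p <- s) pure (alpha p.1) p.2.
Proof.
by apply: tensor_lift_pi => *; rewrite ?raddfD ?pureDl ?pureDr.
Qed.

Lemma tensor_map_pure g z : tensor_map (pure g z) = pure (alpha g) z.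
Proof. by rewrite tensor_map_pi big_seq1. Qed.

Lemma tensor_map_is_linear : linear tensor_map.
Proof.
move=> c; move=> u v; case: (tensorP u) (tensorP v) => s -> [t ->].
have -> : c *: \pi_(tensor G K) s + \pi_(tensor G K) t =
    \pi_(tensor G K) (scale_list c s ++ t).
  by rewrite [LHS]/GRing.add /GRing.scale /= tensor_scale_pi tensor_add_pi.
rewrite !tensor_map_pi scaler_sumr big_cat big_map /=; congr (_ + _).
by apply: eq_bigr => p _; rewrite scale_pure.
Qed.

HB.instance Definition _ := GRing.isLinear.Build K (tensor G K) (tensor G K)
  *:%R tensor_map tensor_map_is_linear.

End TensorMap.

Definition is_eigenvalue (K : nzRingType) (V : lmodType K)
    (f : {linear V -> V}) (l : K) : Prop :=
  exists2 v : V, v != 0 & f v = l *: v.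

Definition is_torsion (G : zmodType) (g : G) : Prop :=
  exists2 n : nat, (0 < n)%N & g *+ n = 0.

(* Torsion dies in G (x) C, but an orbit of alpha that stays among nonzero
   torsion elements forever has growth 1. This is invisible as soon as alpha
   (x) 1 has a nonzero eigenvalue (some modulus is then at least 1), but not
   otherwise: 0 x id on Z x Z/2 has growth rate 1 while the only eigenvalue of
   alpha (x) 1 is 0. The condition below excludes such orbits. It holds
   trivially if G is torsion-free. *)
Definition nilpotent_on_torsion (G : zmodType) (alpha : G -> G) : Prop :=
  forall g : G, is_torsion g -> exists m : nat, iter m alpha g = 0.

(* Main.v *)
From HB Require Import structures.
Require Import Defs.
From mathcomp Require Import all_boot all_order all_algebra.
From mathcomp Require Import complex reals ereal.
From mathcomp Require Import boolp classical_sets topology normedtype.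
From mathcomp Require Import sequences exp.
From mathcomp Require Import zify lra.

Import Order.TTheory GRing.Theory Num.Theory.
Import numFieldNormedType.Exports.
Local Open Scope ring_scope.

(** Modulo torsion, [G] is a lattice in a real vector space, and the word
    length is comparable to the norm of the lattice vector; so the growth rate
    of [alpha] is a spectral radius. Writing [rho] for the largest modulus of an
    eigenvalue of [T], the map induced by [alpha] on the complexified group:

    Coordinates. From the generators one extracts a free family [t] and an
    integer [k > 0] such that [k G] lies in the span of [t]
    ([rational_coordinates_exist]). The coefficients of [g *+ k] are an integer
    vector [c g], and the l1 norm of [c g] is comparable to the word length of
    [g], up to an additive constant that absorbs the torsion
    ([coord_norm_le_length], [length_le_coord_norm]). The same coefficients
    identify the tensor product with a space of row vectors
    ([tensor_coord_inj], [tensor_coord_surj]), so that [T] becomes a matrix.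

    Upper bound. By Cayley-Hamilton every vector is killed by a product of
    factors [T - l] over the eigenvalues [l]; removing the factors one by one
    shows that orbits grow at most like [s ^+ m] for every [s > rho]
    ([orbit_bound]). If [rho >= 1] the additive constant is harmless. If
    [rho < 1] the orbits tend to 0 in coordinates, and since the coordinates are
    integers they vanish eventually ([coord_orbit_vanishes]). Then [T] has no
    nonzero eigenvalue, the non-degeneracy hypothesis says that [alpha] is
    nilpotent on torsion, and every orbit of [alpha] reaches 0
    ([word_length_orbit_bound]).

    Lower bound. An eigenvector is a finite combination of pure tensors, so an
    eigenvalue cannot exceed a common growth bound for all orbits of [alpha]
    ([eigenvalue_le_growth]). *)

(** * Limit superior of m-th roots *)

Section GrowthOfSequences.
Local Open Scope classical_set_scope.
Context {R : realType}.
Implicit Types (a : nat -> R) (r s c : R).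

(** Constant factors do not matter for exponential growth: they are absorbed by
    any increase of the base. *)
Lemma near_geometric_le c r s : 0 <= r -> r < s ->
  \forall m \near \oo, c * r ^+ m <= s ^+ m.
Proof.
move=> r0 rs; have s0 : 0 < s by exact: le_lt_trans rs.
have q1 : `|r / s| < 1.
  by rewrite ger0_norm ?divr_ge0 ?(ltW s0)// ltr_pdivrMr// mul1r.
have H : \forall m \near \oo, c * (r / s) ^+ m <= 1.
  exact: (cvgr_le _ (cvg_geometric c q1) _ ltr01).
near=> m; have : c * (r / s) ^+ m <= 1 by near: m.
by rewrite expr_div_n mulrA ler_pdivrMr ?exprn_gt0// mul1r.
Unshelve. all: by end_near. Qed.

Lemma root_leE (m : nat) (x r : R) : (0 < m)%N -> 0 <= x -> 0 <= r ->
  (powR x (m%:R^-1) <= r) = (x <= r ^+ m).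
Proof.
move=> m0 x0 r0; have m0' : (m%:R : R) != 0 by rewrite pnatr_eq0 -lt0n.
rewrite -[RHS](_ : (powR x (m%:R^-1) ^+ m <= r ^+ m) = _).
  by rewrite ler_pXn2r// nnegrE powR_ge0.
by rewrite -powR_mulrn ?powR_ge0// -powRrM mulVf// powRr1.
Qed.

Lemma limn_esup_root_le a r : (forall m, 0 <= a m) -> 0 <= r ->
  (\forall m \near \oo, a m <= r ^+ m) ->
  (limn_esup (fun m => (powR (a m) (m%:R^-1))%:E) <= r%:E)%E.
Proof.
move=> a0 r0 ar.
have : \forall m \near \oo, powR (a m) (m%:R^-1) <= r.
  near=> m; rewrite root_leE//; first by near: m.
  by near: m; exists 1%N.
move=> H; rewrite /limn_esup /limf_esup.
apply: (@le_trans _ _ (ereal_sup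
  [set (powR (a m) (m%:R^-1))%:E | m in [set m | powR (a m) (m%:R^-1) <= r]])).
  by apply: ereal_inf_lbound; exists [set m | powR (a m) (m%:R^-1) <= r].
by apply: ge_ereal_sup => _ [m /= mr <-]; rewrite lee_fin.
Unshelve. all: by end_near. Qed.

Lemma limn_esup_root_lt a r : (forall m, 0 <= a m) -> 0 <= r ->
  (limn_esup (fun m => (powR (a m) (m%:R^-1))%:E) < r%:E)%E ->
  \forall m \near \oo, a m <= r ^+ m.
Proof.
move=> a0 r0 /ereal_inf_lt[_ [A FA <-] Ar]; near=> m.
rewrite -root_leE//; last by near: m; exists 1%N.
rewrite -lee_fin; apply: le_trans (ltW Ar); apply: ereal_sup_ubound.
by exists m => //; near: m.
Unshelve. all: by end_near. Qed.

End GrowthOfSequences.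

(** * The modulus of complex numbers *)

Section ComplexNorm.
Import ComplexField.Normc.
Context {R : rcfType}.
Implicit Types x y : R[i].

Lemma normc_ge0 x : 0 <= normc x.
Proof. exact: (@normr_ge0 _ (Rcomplex R) x). Qed.

Lemma normcD x y : normc (x + y) <= normc x + normc y.
Proof. exact: le_normcD. Qed.

Lemma normcX x m : normc (x ^+ m) = normc x ^+ m.
Proof. by elim: m => [|m IH]; rewrite ?expr0 ?normc1// !exprS normcM IH. Qed.

Lemma normc_gt0 x : x != 0 -> 0 < normc x.
Proof.
by rewrite lt_def normc_ge0 andbT; apply: contra_neq; apply: eq0_normc.
Qed.

Lemma normc_int (n : int) : normc (n%:~R : R[i]) = (absz n)%:R.
Proof.
have H (k : nat) : normc (k%:R : R[i]) = k%:R.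
  by rewrite [LHS](@normcMn R 1 k) normc1.
case: n => n; first exact: H.
by rewrite NegzE mulrNz [LHS](@normcN R) abszN; exact: H.
Qed.

End ComplexNorm.

(** * Growth of orbits and the spectrum *)

Section OrbitBound.
Import ComplexField.Normc.
Context {R : rcfType} {V : lmodType R[i]} (T : {linear V -> V}) (N : V -> R).
Hypotheses (ND : forall u v, N (u + v) <= N u + N v)
  (NZ : forall c u, N (c *: u) = normc c * N u).

(** Induction on the number of factors: if [w = T v - l *: v] has an orbit
    bounded by [C * s ^+ m], then the norms [x m] of the orbit of [v] satisfy
    [x m.+1 <= normc l * x m + C * s ^+ m], and [normc l < s]. *)
Lemma orbit_bound (s : R) (ls : seq R[i]) (v : V) :
  (forall l, l \in ls -> normc l < s) ->
  foldl (fun w l => T w - l *: w) v ls = 0 ->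
  exists C, forall m, N (iter m T v) <= C * s ^+ m.
Proof.
elim: ls v => [|l ls IH] v /= lts.
  move=> ->; exists 0 => m; rewrite mul0r.
  suff -> : iter m T 0 = 0 by rewrite -(scale0r 0) NZ normc0 mul0r.
  by elim: m => //= m ->; rewrite raddf0.
have ls_s : normc l < s by apply: lts; rewrite mem_head.
have s0 : 0 < s by apply: le_lt_trans ls_s; apply: normc_ge0.
move=> /IH[|C HC]; first by move=> k kls; apply: lts; rewrite in_cons kls orbT.
have d0 : 0 < s - normc l by rewrite subr_gt0.
(* [C'] is the least constant with [N v <= C'] and [normc l * C' + C <= C' * s],
   which is what the induction step needs. *)
pose C' := Num.max (N v) (C / (s - normc l)).
exists C'; elim=> [|m IHm]; first by rewrite mulr1 le_max lexx.
have -> : iter m.+1 T v = iter m T (T v - l *: v) + l *: iter m T v.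
  suff -> : iter m T (T v - l *: v) = iter m.+1 T v - l *: iter m T v.
    by rewrite subrK.
  by elim: m {IHm} => //= m ->; rewrite linearB linearZ.
apply: le_trans (ND _ _) _; rewrite NZ.
apply: le_trans (lerD (HC m) (ler_wpM2l (normc_ge0 l) IHm)) _.
rewrite exprS !mulrA -mulrDl; apply: ler_wpM2r; first by rewrite exprn_ge0 ?ltW.
rewrite -lerBrDr [C' * s]mulrC -mulrBl -ler_pdivrMl// mulrC.
by rewrite le_max lexx orbT.
Qed.

End OrbitBound.

(** The product of the factors of the characteristic polynomial, written as a
    fold so that it makes sense for any linear map and transfers along
    linear isomorphisms. *)
Lemma eigenvalue_factorization (F : closedFieldType) (n : nat) (B : 'M[F]_n) :
  exists ls : seq F, (forall l, (l \in ls) = eigenvalue B l) /\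
    (forall u : 'rV_n, foldl (fun w l => w *m B - l *: w) u ls = 0).
Proof.
(* Cayley-Hamilton is about the ring of square matrices of positive size. *)
case: n B => [|n] B.
  exists [::]; split=> [l|u]; last by rewrite [LHS]thinmx0.
  by apply/esym/negbTE/negP => /eigenvalueP[v _]; rewrite [v]thinmx0 eqxx.
have [ls] := closed_field_poly_normal (char_poly B).
rewrite (monicP (char_poly_monic B)) scale1r => Els.
exists ls; split=> [l|u]; first by rewrite eigenvalue_root_char Els root_prod_XsubC.
have H v rs : foldl (fun w l => w *m B - l *: w) v rs =
    v *m horner_mx B (\prod_(l <- rs) ('X - l%:P)).
  elim: rs v => [|l rs IH] v; first by rewrite big_nil rmorph1 mulmx1.
  rewrite big_cons /= IH rmorphM /= rmorphB /= horner_mx_X horner_mx_C.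
  by rewrite mulmxA mulmxBr mul_mx_scalar.
by rewrite H -Els Cayley_Hamilton mulmx0.
Qed.

(** * Word length *)

Section WordLength.
Context {G : zmodType} {S : seq G} (genS : generates S).
Local Notation len := (word_length S).

Lemma word_length_le g w : is_word S g w -> (len g <= size w)%N.
Proof. by move=> gw; have [_] := word_lengthP g genS; apply. Qed.

Lemma word_length_geodesic g : exists2 w, is_word S g w & size w = len g.
Proof. by have [] := word_lengthP g genS. Qed.

Lemma word_length0 : len 0 = 0%N.
Proof.
apply/eqP; rewrite -leqn0; apply: (@word_length_le 0 [::]).
by split; rewrite ?big_nil.
Qed.

Lemma word_lengthD g h : (len (g + h) <= len g + len h)%N.
Proof.
have [v [Sv gv] <-] := word_length_geodesic g.
have [w [Sw hw] <-] := word_length_geodesic h.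
rewrite -size_cat; apply: word_length_le.
by split; rewrite ?all_cat ?Sv// big_cat /= gv hw.
Qed.

Lemma word_lengthN g : (len (- g) <= len g)%N.
Proof.
have [w [Sw gw] <-] := word_length_geodesic g.
rewrite -(size_map -%R); apply: word_length_le; split.
  rewrite all_map; apply: sub_all Sw => x /=.
  by rewrite opprK orbC.
by rewrite big_map sumrN gw.
Qed.

Lemma word_lengthMz g (n : int) : (len (g *~ n) <= absz n * len g)%N.
Proof.
have H k : (len (g *+ k) <= k * len g)%N.
  elim: k => [|k IH]; first by rewrite mulr0n word_length0.
  by rewrite mulrS mulSn (leq_trans (word_lengthD _ _)) ?leq_add2l.
case: n => n; first exact: H.
by rewrite NegzE mulrNz abszN (leq_trans (word_lengthN _)) ?H.
Qed.

Lemma word_length_sum I (s : seq I) (F : I -> G) :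
  (len (\sum_(i <- s) F i) <= \sum_(i <- s) len (F i))%N.
Proof.
elim: s => [|i s IH]; first by rewrite !big_nil word_length0.
by rewrite !big_cons (leq_trans (word_lengthD _ _)) ?leq_add2l.
Qed.

Lemma generated_ind (P : G -> Prop) : P 0 ->
  (forall g x, x \in S -> P g -> P (g + x) /\ P (g - x)) -> forall g, P g.
Proof.
move=> P0 PD g; have [w [Sw <-]] := genS g.
elim: w Sw => [|x w IH] /=; first by rewrite big_nil.
rewrite big_cons addrC => /andP[/orP[xS|xS] /IH Pw].
  by have [] := PD _ _ xS Pw.
by have [_] := PD _ _ xS Pw; rewrite opprK.
Qed.

(** A seminorm is bounded on the finite set of generators, and each letter of a
    geodesic word contributes at most that bound. *)
Lemma lipschitz_word_length (f : G -> nat) : f 0 = 0%N ->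
  (forall x y : G, f (x + y)%R <= f x + f y)%N -> (forall x, f (- x) = f x) ->
  exists C, forall g, (f g <= C * len g)%N.
Proof.
move=> f0 fD fN; exists (\sum_(x <- S) f x)%N => g.
have [w [Sw <-] <-] := word_length_geodesic g.
elim: w Sw => [|x w IH] /=; first by rewrite big_nil f0.
rewrite big_cons mulnS => /andP[xS /IH le_w].
apply: leq_trans (fD _ _) (leq_add _ le_w).
have le_S y : y \in S -> (f y <= \sum_(x <- S) f x)%N.
  by move=> yS; rewrite (big_rem y)//= leq_addr.
by case/orP: xS => /le_S //; rewrite fN.
Qed.

End WordLength.

(** * Rational coordinates on a finitely generated abelian group *)

Section Coordinates.
Context {G : zmodType}.

Definition zspan {r} (t : 'I_r -> G) (g : G) :=
  exists c : 'rV[int]_r, g = \sum_j t j *~ c 0 j.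

Lemma zspanD r (t : 'I_r -> G) g h : zspan t g -> zspan t h -> zspan t (g + h).
Proof.
move=> [c ->] [d ->]; exists (c + d); rewrite -big_split /=.
by apply: eq_bigr => j _; rewrite mxE mulrzDr.
Qed.

Lemma zspanMz r (t : 'I_r -> G) g n : zspan t g -> zspan t (g *~ n).
Proof.
move=> [c ->]; exists (n *: c); rewrite mulrz_suml.
by apply: eq_bigr => j _; rewrite mxE mulrC mulrzA.
Qed.

Definition zfree {r} (t : 'I_r -> G) :=
  forall c : 'rV[int]_r, \sum_j t j *~ c 0 j = 0 -> c = 0.

(** Adding a generator [x] either leaves the family unchanged, when some nonzero
    multiple of [x] lies in its span (and [k] is then multiplied by that
    multiple), or extends the free family by [x]. *)
Lemma zfree_of_seq (s : seq G) : exists r (t : 'I_r -> G) (k : nat),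
  [/\ zfree t, (0 < k)%N & forall x, x \in s -> zspan t (x *+ k)].
Proof.
elim: s => [|x s [r [t [k [free_t k0 span_t]]]]].
  by exists 0%N, (fun=> 0), 1%N; split=> // c _; rewrite [c]thinmx0.
have [[d [d0 tx]]|free_x] := pselect (exists d : int, d != 0 /\ zspan t (x *~ d)).
  exists r, t, (k * absz d)%N; split=> //.
    by rewrite muln_gt0 k0 absz_gt0.
  move=> y; rewrite in_cons => /orP[/eqP ->|/span_t ty]; last first.
    by rewrite mulrnA pmulrn; apply: zspanMz.
  rewrite mulnC mulrnA pmulrn; apply: zspanMz.
  have /orP[/eqP e|/eqP e] : (d == absz d) || (- d == absz d) by lia.
    by rewrite pmulrn -e.
  by rewrite pmulrn -e mulrNz -mulrN1z; apply: zspanMz.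
exists r.+1, (fun j => oapp t x (unlift ord0 j)), k.
have sumE (c : 'rV[int]_r.+1) :
    \sum_j (oapp t x (unlift ord0 j)) *~ c 0 j =
    x *~ c 0 ord0 + \sum_j t j *~ c 0 (lift ord0 j).
  rewrite big_ord_recl unlift_none /=; congr (_ + _).
  by apply: eq_bigr => j _; rewrite liftK.
have span_t' g : zspan t g -> zspan (fun j => oapp t x (unlift ord0 j)) g.
  move=> [c ->]; exists (\row_j oapp (c 0) 0 (unlift ord0 j)).
  rewrite sumE mxE unlift_none mulr0z add0r.
  by apply: eq_bigr => j _; rewrite mxE liftK.
split=> //.
- move=> c; rewrite sumE => c0.
  have c00 : c 0 ord0 = 0.
    apply: contrapT => /eqP c00; apply: free_x; exists (c 0 ord0); split=> //.
    exists (- \row_j c 0 (lift ord0 j)).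
    move/eqP: c0; rewrite addr_eq0 => /eqP ->; rewrite -sumrN.
    by apply: eq_bigr => j _; rewrite !mxE mulrNz.
  move: c0; rewrite c00 mulr0z add0r => c0.
  have /rowP c'0 : \row_j c 0 (lift ord0 j) = 0.
    by apply: free_t; rewrite -[RHS]c0; apply: eq_bigr => j _; rewrite mxE.
  apply/rowP => j; rewrite mxE; case: (unliftP ord0 j) => [i|] -> //.
  by have := c'0 i; rewrite !mxE.
- move=> y; rewrite in_cons => /orP[/eqP ->|/span_t/span_t'//].
  exists (\row_j oapp (fun=> 0) k%:Z (unlift ord0 j)).
  rewrite sumE mxE unlift_none big1 ?addr0// => j _.
  by rewrite mxE liftK mulr0z.
Qed.

(** [c g] is [k] times the coordinate vector of [g] in the basis [t] of the group
    modulo torsion with rational coefficients; the factor [k] makes it integral.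
    In particular [c g = 0] forces [g *+ k = 0]. *)
Record rational_coordinates {r : nat} (k : nat) (t : 'I_r -> G)
    (c : G -> 'rV[int]_r) : Prop := RationalCoordinates {
  coord_k_gt0 : (0 < k)%N;
  coordD : {morph c : g h / g + h};
  coord_expand : forall g, g *+ k = \sum_j t j *~ c g 0 j;
  coord_basis : forall i, c (t i) = k%:Z *: delta_mx 0 i }.

Lemma rational_coordinates_exist (S : seq G) : generates S ->
  exists r k (t : 'I_r -> G) c, rational_coordinates k t c.
Proof.
move=> genS; have [r [t [k [free_t k0 span_t]]]] := zfree_of_seq S.
have /choice[c cE] g : zspan t (g *+ k).
  elim/(generated_ind genS): g => [|g x xS tg].
    by exists 0; rewrite mul0rn big1// => j _; rewrite mxE mulr0z.
  split; rewrite ?mulrnBl ?mulrnDl; apply: zspanD => //; first exact: span_t.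
  by rewrite -mulrN1z; apply: zspanMz; apply: span_t.
have uniq (c1 c2 : 'rV[int]_r) :
    \sum_j t j *~ c1 0 j = \sum_j t j *~ c2 0 j -> c1 = c2.
  move/eqP; rewrite -subr_eq0 -sumrB => /eqP e0.
  apply/subr0_eq/free_t; rewrite -[RHS]e0.
  by apply: eq_bigr => j _; rewrite !mxE mulrzBr.
exists r, k, t, c; split=> // [g h|i]; apply: uniq.
  rewrite -cE mulrnDl !cE -big_split; apply: eq_bigr => j _.
  by rewrite mxE mulrzDr.
rewrite -cE (bigD1 i)//= big1 ?addr0 => [|j ji]; rewrite !mxE ?eqxx ?mulr1//.
by rewrite (negbTE ji) mulr0 mulr0z.
Qed.

End Coordinates.

Arguments coord_k_gt0 {G r k t c}.
Arguments coordD {G r k t c}.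
Arguments coord_expand {G r k t c}.
Arguments coord_basis {G r k t c}.

(** * Word length and coordinates *)

Section CoordinateLength.
Context {G : zmodType} {S : seq G} (genS : generates S) {r k : nat}
  {t : 'I_r -> G} {c : G -> 'rV[int]_r} (co : rational_coordinates k t c).
Local Notation len := (word_length S).

Definition norm1 {n} (u : 'rV[int]_n) : nat := (\sum_j absz (u 0%R j))%N.

Lemma norm1D n (u v : 'rV[int]_n) : (norm1 (u + v) <= norm1 u + norm1 v)%N.
Proof.
rewrite /norm1 -big_split /=; apply: leq_sum => j _; rewrite mxE.
by move: (u _ _) (v _ _) => a b; lia.
Qed.

Lemma norm1N n (u : 'rV[int]_n) : norm1 (- u) = norm1 u.
Proof. by apply: eq_bigr => j _; rewrite mxE abszN. Qed.

Lemma coord_zero : c 0 = 0.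
Proof. by apply: (addrI (c 0)); rewrite -(coordD co) !addr0. Qed.

Lemma coord_opp g : c (- g) = - c g.
Proof. by apply/eqP; rewrite -addr_eq0 -(coordD co) addNr coord_zero. Qed.

Lemma coordMn g n : c (g *+ n) = c g *+ n.
Proof.
elim: n => [|n IH]; first exact: coord_zero.
by rewrite !mulrS (coordD co) IH.
Qed.

Lemma coord_norm_le_length : exists C, forall g, (norm1 (c g) <= C * len g)%N.
Proof.
apply: lipschitz_word_length => // [|x y|x].
- by rewrite coord_zero /norm1 big1// => j _; rewrite mxE.
- by rewrite (coordD co) norm1D.
- by rewrite coord_opp norm1N.
Qed.

Lemma int_combination g : exists n : 'I_(size S) -> int,
  g = \sum_(i < size S) S`_i *~ n i.
Proof.
elim/(generated_ind genS): g => [|g x xS [n ->]].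
  by exists (fun=> 0); rewrite big1// => i _; rewrite mulr0z.
have xi : (index x S < size S)%N by rewrite index_mem.
have H (e : int) : exists m : 'I_(size S) -> int,
    \sum_(i < size S) S`_i *~ n i + x *~ e = \sum_(i < size S) S`_i *~ m i.
  exists (fun i => n i + (if i == Ordinal xi then e else 0)).
  rewrite [RHS](eq_bigr (fun i : 'I_(size S) => S`_i *~ n i +
     (if i == Ordinal xi then S`_i *~ e else 0))); last first.
    by move=> i _; rewrite mulrzDr; case: eqP; rewrite ?mulr0z.
  by rewrite big_split /= -big_mkcond big_pred1_eq /= nth_index.
by split; [have [m e] := H 1 | have [m e] := H (-1)]; exists m;
  rewrite -e ?mulrN1z.
Qed.

(** Dividing the exponents of the generators by [k] writes [g = q *+ k + h]
    where [h] ranges over a set of bounded length and [q *+ k] lies in the span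
    of [t], hence is spelled by its coordinates. The constant [D] absorbs
    the torsion elements, whose coordinates are zero. *)
Lemma length_le_coord_norm : exists C D,
  forall g, (len g <= C * norm1 (c g) + D)%N.
Proof.
have [L HL] := coord_norm_le_length.
pose M := (\sum_j len (t j))%N.
have lenM l (d : 'rV[int]_r) : l = \sum_j t j *~ d 0 j ->
    (len l <= M * norm1 d)%N.
  move=> ->; apply: leq_trans (word_length_sum genS _ _ _) _.
  rewrite /norm1 big_distrr /=; apply: leq_sum => j _.
  apply: leq_trans (word_lengthMz genS _ _) _; rewrite mulnC leq_mul2r.
  by rewrite /M (bigD1 j)//= leq_addr orbT.
pose D := (k * \sum_(i < size S) len S`_i)%N.
exists M, (M * (L * D) + D)%N => g.
have [n Eg] := int_combination g.
have k0 : (k%:Z != 0) by have := coord_k_gt0 co; lia.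
pose h := \sum_(i < size S) S`_i *~ (n i %% k)%Z.
pose q := \sum_(i < size S) S`_i *~ (n i %/ k)%Z.
have Egh : g = q *+ k + h.
  rewrite Eg /q /h -sumrMnl -big_split /=; apply: eq_bigr => i _.
  by rewrite {1}[n i](divz_eq _ k) mulrzDr pmulrn mulrzA.
have len_h : (len h <= D)%N.
  apply: leq_trans (word_length_sum genS _ _ _) _.
  rewrite /D big_distrr /=; apply: leq_sum => i _.
  apply: leq_trans (word_lengthMz genS _ _) _; rewrite leq_mul2r.
  have := modz_ge0 (n i) k0; have := ltz_mod (n i) k0; lia.
have len_q : (len (q *+ k) <= M * norm1 (c q))%N.
  by apply: lenM; rewrite (coord_expand co).
have norm_q : (norm1 (c q) <= norm1 (c g) + L * D)%N.
  apply: leq_trans (_ : norm1 (c (q *+ k)) <= _)%N.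
    rewrite coordMn; apply: leq_sum => j _.
    by rewrite mulmxnE pmulrn -mulrzr intz abszM leq_pmulr// (coord_k_gt0 co).
  have -> : q *+ k = g + - h by rewrite Egh addrK.
  rewrite (coordD co) coord_opp (leq_trans (norm1D _ _ _))// norm1N leq_add2l.
  by rewrite (leq_trans (HL _))// leq_mul2l len_h orbT.
rewrite {1}Egh (leq_trans (word_lengthD genS _ _))// addnA leq_add//.
by rewrite (leq_trans len_q)// -mulnDr leq_mul2l norm_q orbT.
Qed.

End CoordinateLength.

(** * The complexified group and the induced map *)

Section TensorCoordinates.
Import ComplexField.Normc.
Context {R : rcfType} {G : zmodType} {r k : nat}
  {t : 'I_r -> G} {c : G -> 'rV[int]_r} (co : rational_coordinates k t c).
Local Notation K := R[i].
Local Notation V := (tensor G K).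

(** [pure] with the group argument last, so that it can carry the structure of an
    additive map. *)
Definition pure_at (z : K) (g : G) : V := pure g z.

Lemma pure_at_is_zmod_morphism z : zmod_morphism (pure_at z).
Proof.
move=> g h; apply/eqP; rewrite eq_sym subr_eq /pure_at -pureDl.
by rewrite subrK.
Qed.

HB.instance Definition _ z :=
  GRing.isZmodMorphism.Build G V (pure_at z) (pure_at_is_zmod_morphism z).

Definition tensor_coord : V -> 'rV[K]_r :=
  tensor_lift (fun g z => z *: map_mx intr (c g)).

Lemma tensor_coord_pi s : tensor_coord (\pi_(tensor G K)%qT s) =
  \sum_(p <- s) p.2 *: map_mx intr (c p.1).
Proof.
apply: tensor_lift_pi => [g h z|g y z]; last by rewrite scalerDl.
by rewrite (coordD co) map_mxD scalerDr.
Qed.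

Lemma tensor_coord_is_linear : linear tensor_coord.
Proof.
move=> a u v; case: (tensorP u) (tensorP v) => s -> [s' ->].
have -> : a *: \pi_(tensor G K)%qT s + \pi_(tensor G K)%qT s' =
    \pi_(tensor G K)%qT (scale_list a s ++ s').
  by rewrite [LHS]/GRing.add /GRing.scale /= tensor_scale_pi tensor_add_pi.
rewrite !tensor_coord_pi big_cat big_map scaler_sumr; congr (_ + _).
by apply: eq_bigr => p _; rewrite scalerA.
Qed.

HB.instance Definition _ := GRing.isLinear.Build K V 'rV[K]_r *:%R
  tensor_coord tensor_coord_is_linear.

Lemma tensor_coordB u v : tensor_coord (u - v) = tensor_coord u - tensor_coord v.
Proof. exact: raddfB. Qed.

Lemma tensor_coordZ a u : tensor_coord (a *: u) = a *: tensor_coord u.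
Proof. exact: linearZ. Qed.

Lemma tensor_coord_sum I (s : seq I) (F : I -> V) :
  tensor_coord (\sum_(i <- s) F i) = \sum_(i <- s) tensor_coord (F i).
Proof. exact: linear_sum. Qed.

Lemma tensor_coord_pure g z :
  tensor_coord (pure g z) = z *: map_mx intr (c g).
Proof. by rewrite tensor_coord_pi big_seq1. Qed.

(** The family [t] spans the tensor product: division by [k] is possible there,
    and [pure (g *+ k) z] expands along [t]. Injectivity of the coordinates is
    an immediate consequence. *)
Lemma tensor_coord_expand u :
  u *+ k = \sum_j tensor_coord u 0 j *: pure (t j) 1.
Proof.
case: (tensorP u) => s ->; rewrite pi_sum_pure -sumrMnl raddf_sum.
under [RHS]eq_bigr do rewrite summxE scaler_suml.
rewrite exchange_big /=; apply: eq_bigr => -[g z] _ /=.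
rewrite -[LHS](raddfMn (pure_at z)) (coord_expand co) raddf_sum.
apply: eq_bigr => j _; rewrite tensor_coord_pure !mxE raddfMz -scaler_int.
by rewrite /pure_at !scale_pure mulr1 mulrC.
Qed.

Let k_neq0 : (k%:R : K) != 0.
Proof. by rewrite pnatr_eq0 -lt0n (coord_k_gt0 co). Qed.

Lemma tensor_coord_inj : injective tensor_coord.
Proof.
move=> u v uv; apply: (scalerI k_neq0).
by rewrite !scaler_nat !tensor_coord_expand uv.
Qed.

Lemma tensor_coord_surj x : exists u, tensor_coord u = x.
Proof.
exists (\sum_j (k%:R^-1 * x 0 j) *: pure (t j) 1).
apply/rowP => j; rewrite raddf_sum summxE (bigD1 j)//= big1 ?addr0 => [|i ij].
  rewrite linearZ /= tensor_coord_pure (coord_basis co) !mxE !eqxx.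
  by rewrite mul1r mulr1 mulrAC -pmulrn mulVf ?mul1r.
rewrite linearZ /= tensor_coord_pure (coord_basis co) !mxE eq_sym (negbTE ij).
by rewrite andbF !mulr0.
Qed.

Definition tensor_norm (u : V) : R := \sum_j normc (tensor_coord u 0 j).

Lemma tensor_norm_ge0 u : 0 <= tensor_norm u.
Proof. by apply: sumr_ge0 => j _; apply: normc_ge0. Qed.

Lemma tensor_normD u v : tensor_norm (u + v) <= tensor_norm u + tensor_norm v.
Proof.
rewrite /tensor_norm -big_split; apply: ler_sum => j _.
by rewrite raddfD mxE normcD.
Qed.

Lemma tensor_normZ a u : tensor_norm (a *: u) = normc a * tensor_norm u.
Proof.
rewrite /tensor_norm mulr_sumr; apply: eq_bigr => j _.
by rewrite linearZ mxE normcM.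
Qed.

Lemma tensor_norm_gt0 u : u != 0 -> 0 < tensor_norm u.
Proof.
move=> u0; rewrite lt_def tensor_norm_ge0 andbT; apply: contra_neq u0.
move=> /eqP; rewrite psumr_eq0 => [/allP u0|j _]; last exact: normc_ge0.
apply: tensor_coord_inj; rewrite raddf0; apply/rowP => j; rewrite mxE.
by apply: eq0_normc; apply/eqP/(implyP (u0 j _)); rewrite ?mem_index_enum.
Qed.

Lemma tensor_norm_pure g : tensor_norm (pure g 1) = (norm1 (c g))%:R.
Proof.
rewrite /tensor_norm /norm1 natr_sum; apply: eq_bigr => j _.
by rewrite tensor_coord_pure !mxE mul1r normc_int.
Qed.

Context (alpha : {additive G -> G}).
Local Notation T := (@tensor_map G K alpha).

Lemma iter_tensor_map_pure m g z :
  iter m T (pure g z) = pure (iter m alpha g) z.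
Proof. by elim: m => //= m ->; rewrite tensor_map_pure. Qed.

(** Row-vector convention; the factor [k%:R^-1] compensates [tensor_coord]
    sending [pure (t i) 1] to [k] times a basis vector. *)
Definition tensor_map_mx : 'M[K]_r :=
  \matrix_(i, j) (k%:R^-1 * tensor_coord (T (pure (t i) 1)) 0 j).

Lemma tensor_coord_map u : tensor_coord (T u) = tensor_coord u *m tensor_map_mx.
Proof.
have TZ a v : T (a *: v) = a *: T v by exact: linearZ.
have Tsum (F : 'I_r -> V) : T (\sum_i F i) = \sum_i T (F i).
  exact: linear_sum.
have Tu : k%:R *: T u = \sum_i tensor_coord u 0 i *: T (pure (t i) 1).
  rewrite -TZ scaler_nat tensor_coord_expand.
  by rewrite Tsum; apply: eq_bigr => i _; rewrite TZ.
apply: (scalerI k_neq0); rewrite -tensor_coordZ Tu tensor_coord_sum.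
apply/rowP => j; rewrite summxE !mxE mulr_sumr; apply: eq_bigr => i _.
by rewrite tensor_coordZ !mxE mulrCA; congr (_ * _); rewrite mulrA mulfV ?mul1r.
Qed.

Lemma is_eigenvalue_tensor_map l :
  is_eigenvalue T l <-> eigenvalue tensor_map_mx l.
Proof.
split=> [[u u0 Tu]|/eigenvalueP[x xB x0]].
  apply/eigenvalueP; exists (tensor_coord u).
    by rewrite -tensor_coord_map Tu linearZ.
  by apply: contra_neq u0 => u0; apply: tensor_coord_inj; rewrite u0 raddf0.
have [u ux] := tensor_coord_surj x; exists u.
  by apply: contra_neq x0 => u0; rewrite -ux u0 raddf0.
by apply: tensor_coord_inj; rewrite tensor_coord_map tensor_coordZ ux.
Qed.

Lemma tensor_map_spectrum : exists eigs : seq K,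
  (forall l, l \in eigs <-> is_eigenvalue T l) /\
  (forall u, foldl (fun w l => T w - l *: w) u eigs = 0).
Proof.
have [ls [ls_eig ls0]] := eigenvalue_factorization _ _ tensor_map_mx.
exists ls; split=> [l|u]; first by rewrite ls_eig is_eigenvalue_tensor_map.
apply: tensor_coord_inj; rewrite raddf0 -(ls0 (tensor_coord u)).
elim: {ls_eig ls0} ls u => [|l ls IH] u //=; rewrite IH.
by rewrite tensor_coordB tensor_coord_map tensor_coordZ.
Qed.

End TensorCoordinates.

(** * Growth of the orbits of an endomorphism *)

Section OrbitGrowth.
Import ComplexField.Normc.
Local Open Scope classical_set_scope.
Context {R : realType} {G : zmodType} {S : seq G} (genS : generates S).
Context {r k : nat} {t : 'I_r -> G} {c : G -> 'rV[int]_r}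
  (co : rational_coordinates k t c) (alpha : {additive G -> G}).
Local Notation K := R[i].
Local Notation V := (tensor G K).
Local Notation T := (@tensor_map G K alpha).
Local Notation N := (@tensor_norm R G r c).

(** Pure tensors span, so a growth bound on the orbits in the group passes to all
    tensors. The constant depends on the tensor. *)
Lemma tensor_orbit_bound (s : R) (u : V) :
  (forall g, exists C, \forall m \near \oo,
    (norm1 (c (iter m alpha g)))%:R <= C * s ^+ m) ->
  exists C, \forall m \near \oo, N (iter m T u) <= C * s ^+ m.
Proof.
move=> bnd; have iterTD m (v w : V) : iter m T (v + w) = iter m T v + iter m T w.
  by elim: m => //= m ->; apply: raddfD.
have iterTZ m a (v : V) : iter m T (a *: v) = a *: iter m T v.
  by elim: m => //= m ->; apply: linearZ.
case: (tensorP u) => w ->; rewrite pi_sum_pure.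
elim: w => [|[g z] w [C HC]].
  exists 0; near=> m; rewrite big_nil mul0r -(scale0r 0) iterTZ.
  by rewrite (tensor_normZ co) normc0 mul0r.
have [D HD] := bnd g; exists (normc z * D + C); near=> m.
rewrite big_cons iterTD /= -[z in pure g z]mulr1 -scale_pure iterTZ.
rewrite iter_tensor_map_pure mulrDl.
apply: le_trans (tensor_normD co _ _) (lerD _ _); last by near: m.
rewrite (tensor_normZ co) (tensor_norm_pure co) -mulrA.
by apply: ler_wpM2l; [exact: normc_ge0 | near: m].
Unshelve. all: by end_near. Qed.

(** The orbit of an eigenvector [u] has norms [normc l ^+ m * N u], which outgrow
    any [C * s ^+ m] with [s < normc l]. *)
Lemma eigenvalue_le_growth (s : R) (l : K) : 0 < s ->
  (forall g, exists C, \forall m \near \oo,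
    (norm1 (c (iter m alpha g)))%:R <= C * s ^+ m) ->
  is_eigenvalue T l -> normc l <= s.
Proof.
move=> s0 bnd [u u0 Tu]; rewrite leNgt; apply/negP => sl.
have [C HC] := tensor_orbit_bound s u bnd.
have Nu := tensor_norm_gt0 co _ u0.
have iterTu m : iter m T u = l ^+ m *: u.
  elim: m => [|m IH]; first by rewrite scale1r.
  rewrite /= IH exprSr -scalerA -Tu; exact: linearZ.
have Hl := near_geometric_le ((C + 1) / N u) _ _ (ltW s0) sl.
near \oo => m.
have : N (iter m T u) <= C * s ^+ m by near: m.
have : (C + 1) / N u * s ^+ m <= normc l ^+ m by near: m.
rewrite iterTu (tensor_normZ co) normcX mulrAC ler_pdivrMr// => h1 h2.
have := le_trans h1 h2; rewrite mulrDl mul1r gerDl leNgt.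
by rewrite exprn_gt0.
Unshelve. all: by end_near. Qed.

Context (eigs : seq K)
  (eigs0 : forall u, foldl (fun w l => T w - l *: w) u eigs = 0)
  (rho : R) (rho_ge0 : 0 <= rho)
  (le_rho : forall l, l \in eigs -> normc l <= rho).

Lemma coord_orbit_bound (s : R) g : rho < s ->
  exists C, forall m, (norm1 (c (iter m alpha g)))%:R <= C * s ^+ m.
Proof.
move=> rho_s.
have [|C HC] := orbit_bound T N (tensor_normD co) (tensor_normZ co) s eigs
  (pure g 1) _ (eigs0 _).
  by move=> l /le_rho /le_lt_trans; apply.
exists C => m; have := HC m.
by rewrite iter_tensor_map_pure (tensor_norm_pure co).
Qed.

(** An integral vector of norm less than 1 is zero. *)
Lemma coord_orbit_vanishes g : rho < 1 ->
  \forall m \near \oo, norm1 (c (iter m alpha g)) = 0%N.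
Proof.
move=> rho1; have [C HC] := coord_orbit_bound ((rho + 1) / 2) g (midf_lt rho1).1.
have H := near_geometric_le (2 * C) ((rho + 1) / 2) 1.
have {}H : \forall m \near \oo, 2 * C * ((rho + 1) / 2) ^+ m <= 1 ^+ m.
  by apply: H; [rewrite divr_ge0 ?addr_ge0 | exact: (midf_lt rho1).2].
near=> m.
have : 2 * C * ((rho + 1) / 2) ^+ m <= 1 ^+ m by near: m.
rewrite expr1n -mulrA => h2; have h1 := HC m.
apply/eqP; rewrite -leqn0 -ltnS -(ltr_nat R); lra.
Unshelve. all: by end_near. Qed.

(** For [1 <= rho] the additive constant in the comparison of length and
    coordinates is at most a constant times [s0 ^+ m], since [s0 > 1]. For
    [rho < 1] all orbits vanish in coordinates, so they end in torsion elements
    and, by nilpotency on torsion, at 0. *)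
Lemma word_length_orbit_bound (s : R) g : rho < s ->
  (exists2 l, is_eigenvalue T l & l != 0) \/ nilpotent_on_torsion alpha ->
  \forall m \near \oo, (word_length S (iter m alpha g))%:R <= s ^+ m.
Proof.
move=> rho_s nondeg; have [rho1|rho1] := leP 1 rho.
  have [M [D HMD]] := length_le_coord_norm genS co.
  have [rs sr] := midf_lt rho_s; pose s0 := (rho + s) / 2.
  have [C HC] := coord_orbit_bound s0 g rs.
  have H : \forall m \near \oo, (M%:R * C + D%:R) * s0 ^+ m <= s ^+ m.
    by apply: near_geometric_le => //; rewrite (le_trans rho_ge0)// ltW.
  near=> m; apply: le_trans (_ : _ <= (M%:R * C + D%:R) * s0 ^+ m) _.
    apply: le_trans (_ : _ <= M%:R * (norm1 (c (iter m alpha g)))%:R + D%:R) _.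
      by rewrite -natrM -natrD ler_nat HMD.
    rewrite mulrDl -mulrA lerD ?ler_wpM2l// ler_peMr// exprn_ege1//.
    by rewrite (le_trans rho1)// ltW.
  by near: m.
(* A nonzero eigenvalue is excluded: its modulus would be at most every
   positive [e], all orbits being eventually zero in coordinates. *)
have nilp : nilpotent_on_torsion alpha.
  case: nondeg => // -[l l_eig l0]; exfalso; move: (normc_gt0 _ l0).
  rewrite ltNge => /negP; apply.
  apply/ler_addgt0Pr => e e0; rewrite add0r.
  apply: eigenvalue_le_growth e0 _ l_eig => h.
  exists 0; have H := coord_orbit_vanishes h rho1.
  by near=> m; rewrite mul0r (_ : norm1 _ = 0%N)//; near: m.
have [m0 _ Hm0] := coord_orbit_vanishes g rho1.
have [m1 Hm1] : exists m1, iter m1 alpha (iter m0 alpha g) = 0.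
  apply: nilp; exists k; first exact: coord_k_gt0 co.
  rewrite (coord_expand co) big1// => j _.
  have /eqP := Hm0 m0 (leqnn m0); rewrite sum_nat_eq0 => /forallP/(_ j) /=.
  by rewrite absz_eq0 => /eqP ->; rewrite mulr0z.
near=> m; have -> : iter m alpha g = 0.
  have /subnK <- : (m1 + m0 <= m)%N by near: m; exists (m1 + m0)%N.
  rewrite iterD iterD Hm1.
  by elim: (m - _)%N => //= n ->; rewrite raddf0.
by rewrite word_length0// exprn_ge0// ltW// (le_lt_trans rho_ge0).
Unshelve. all: by end_near. Qed.

End OrbitGrowth.

Theorem theorem4p1 (R : realType) (G : zmodType) (S : seq G)
    (alpha : {additive G -> G}) (genS : generates S)
    (nondegenerate :
      (exists2 l : R[i], is_eigenvalue (@tensor_map G R[i] alpha) l & l != 0)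
      \/ nilpotent_on_torsion alpha) :
  exists2 eigs : seq R[i],
    (forall l : R[i],
       l \in eigs <-> is_eigenvalue (@tensor_map G R[i] alpha) l) &
    growth_rate S R alpha =
      (\big[Num.max/0]_(l <- eigs) ComplexField.Normc.normc l)%:E.
Proof.
have [r [k [t [c co]]]] := rational_coordinates_exist S genS.
have [eigs [eigsE eigs0]] := tensor_map_spectrum (R := R) co alpha.
exists eigs => //; set rho := \big[Num.max/0]_(l <- eigs) _.
have rho_ge0 : 0 <= rho by exact: bigmax_ge_id.
have le_rho l : l \in eigs -> ComplexField.Normc.normc l <= rho.
  by move=> l_eig; apply: le_bigmax_seq.
apply/eqP; rewrite eq_le; apply/andP; split.
  apply: ge_ereal_sup => _ [g _ <-]; apply/lee_addgt0Pr => e e0.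
  rewrite -EFinD; apply: limn_esup_root_le => //.
    by rewrite addr_ge0// ltW.
  apply: (word_length_orbit_bound genS co alpha eigs eigs0 rho) => //.
  by rewrite ltrDl.
rewrite leNgt; apply/negP => lt_rho.
have esup_le g : (limn_esup (fun m => (powR (word_length S (iter m alpha g))%:R
    (m%:R^-1))%:E) <= growth_rate S R alpha)%E.
  by apply: ereal_sup_ubound; exists g.
have gr_ge0 : (0 <= growth_rate S R alpha)%E.
  apply: le_trans (esup_le 0); apply: limf_esup_ge0 => [|m].
    exact: filter_not_empty.
  by rewrite lee_fin powR_ge0.
(* If the growth rate were smaller than [rho], a real number [s] strictly in
   between would bound all orbits, hence all eigenvalues. *)
have [s s0 [lt_s s_rho]] : exists2 s, 0 < s &
    (growth_rate S R alpha < s%:E)%E /\ s < rho.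
  move: gr_ge0 lt_rho; case: (growth_rate S R alpha) => // x.
  rewrite lee_fin lte_fin => x0 x_rho; have [xs s_rho] := midf_lt x_rho.
  by exists ((x + rho) / 2); rewrite ?(le_lt_trans x0 xs).
have [L HL] := coord_norm_le_length genS co.
move: s_rho; apply/negP; rewrite -leNgt.
rewrite /rho big_seq; apply: bigmax_le => [|l /eigsE l_eig]; first exact: ltW.
apply: (eigenvalue_le_growth co alpha s l s0 _ l_eig) => g; exists L%:R.
have H := limn_esup_root_lt _ _ _ (ltW s0) (le_lt_trans (esup_le g) lt_s).
near=> m; apply: le_trans (_ : _ <= L%:R * (word_length S (iter m alpha g))%:R) _.
  by rewrite -natrM ler_nat HL.
by rewrite ler_wpM2l//; near: m; apply: H => m'.
Unshelve. all: by end_near. Qed.
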